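(* Let $q$ be a prime power, $n,s,k,m$ positive integers and $A=\mathrm M_n(\mathbb F_{q^s})$ regarded as an $\mathbb F_q$-algebra. Then $A^m$ can be generated by $k$ elements as an $\mathbb F_q$-algebra if and only if \[m\le\frac{|\mathrm{Gen}_k(A,\mathbb F_q)|}{s\,|\mathrm{PGL}_n(\mathbb F_{q^s})|}.\] Moreover, \[|\mathrm{Gen}_k(A^m,\mathbb F_q)|=\prod_{i=0}^{m-1}\bigl(|\mathrm{Gen}_k(A,\mathbb F_q)|-i\cdot s\cdot|\mathrm{PGL}_n(\mathbb F_{q^s})|\bigr).\]
   Context: $\mathrm{Gen}_k(B,\mathbb F_q)$ denotes the set of $k$-tuples of elements of $B$ generating $B$ as a unital $\mathbb F_q$-algebra (the non-commutative monomials in them, including $1$, span $B$). *)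

(* Defs.v *)
From HB Require Import structures.
From mathcomp Require Import all_boot all_order all_algebra all_fingroup.
From Stdlib Require Import ClassicalEpsilon.
Set Implicit Arguments. Unset Strict Implicit. Unset Printing Implicit Defensive.
Import GRing.Theory.
Local Open Scope ring_scope.

Definition pbool (P : Prop) : bool :=
  if excluded_middle_informative P then true else false.

(* x : 'I_k -> R generates R as a unital F-algebra, where the F-algebra
   structure is given by the (central) structure map sc : F -> R:
   every element of R is an F-linear combination of non-commutative
   monomials in the x i (the empty monomial being 1). *)
Definition generates (F : Type) (R : pzSemiRingType) (sc : F -> R) (k : nat)
    (x : 'I_k -> R) : Prop :=
  forall b : R, exists ws : seq (F * seq 'I_k),
    b = \sum_(p <- ws) sc p.1 * \prod_(i <- p.2) x i.

Definition Gen (F : Type) (B : finPzSemiRingType) (sc : F -> B) (k : nat)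
    : {set {ffun 'I_k -> B}} :=
  [set x : {ffun 'I_k -> B} | pbool (generates sc x)].

Definition GLscalars (n : nat) (L : finFieldType) : {set {'GL_n[L]}} :=
  [set g : {'GL_n[L]} | is_scalar_mx (GLval g)].

Definition PGL (n : nat) (L : finFieldType) :=
  ('GL_n[L] / GLscalars n L)%g.

Definition matA (L : finFieldType) (n : nat) := 'M[L]_n.
HB.instance Definition _ (L : finFieldType) (n : nat) :=
  GRing.PzRing.on (matA L n).
HB.instance Definition _ (L : finFieldType) (n : nat) :=
  Finite.on (matA L n).
Definition scA (F L : finFieldType) (iota : {rmorphism F -> L}) (n : nat)
    (c : F) : matA L n := (iota c)%:M.
Definition prodmx (L : finFieldType) (n m : nat) := {ffun 'I_m -> 'M[L]_n}.
HB.instance Definition _ (L : finFieldType) (n m : nat) :=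
  GRing.PzRing.on (prodmx L n m).
HB.instance Definition _ (L : finFieldType) (n m : nat) :=
  Finite.on (prodmx L n m).
Definition scAm (F L : finFieldType) (iota : {rmorphism F -> L}) (n m : nat)
    (c : F) : prodmx L n m := [ffun => (iota c)%:M].

(* Main.v *)
Require Import Defs.
From HB Require Import structures.
From mathcomp Require Import all_boot all_order all_algebra all_fingroup.
From mathcomp Require Import all_solvable all_field.
From Stdlib Require Import ClassicalEpsilon.
Import GRing.Theory.
Local Open Scope ring_scope.

Set Implicit Arguments.
Unset Strict Implicit.
Unset Printing Implicit Defensive.

(* Evaluation of non-commutative polynomials at the m components of a k-tuple of
   A^m is onto iff every component generates A and the kernels of the component
   evaluations are pairwise comaximal (Chinese remainders). As A is simple, two
   generating tuples have comaximal kernels unless an F-automorphism of A maps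
   one to the other. Automorphisms act freely on generating tuples, so the i-th
   component has to avoid i orbits of size |Aut_F(A)|. By Skolem-Noether,
   |Aut_F(A)| = |Gal(L/F)| |PGL_n(L)| = s |PGL_n(L)|. *)

Lemma pboolP (P : Prop) : reflect P (pbool P).
Proof.
by rewrite /pbool; case: excluded_middle_informative => h; constructor.
Qed.

Lemma functional_choice (A B : Type) (P : A -> B -> Prop) :
  (forall a, exists b, P a b) -> exists f, forall a, P a (f a).
Proof.
move=> exP.
exists (fun a => sval (constructive_indefinite_description _ (exP a))).
by move=> a; case: constructive_indefinite_description.
Qed.

(** * Tuples with pairwise unrelated entries *)

Section SeparatedTuples.
Variables (T : finType) (X : {set T}) (r : rel T) (e : nat).
Hypothesis r_sym : symmetric r.
Hypothesis r_trans : transitive r.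
Hypothesis r_closed : forall x y, x \in X -> r x y -> y \in X.
Hypothesis card_r : forall x, x \in X -> #|[set y | r x y]| = e.

Let separated (s : seq T) := all (mem X) s && pairwise (fun x y => ~~ r x y) s.

(** Unrelated entries have disjoint [r]-classes, each with [e] elements. *)
Lemma card_has_rel (s : seq T) :
  separated s -> #|[set x in X | has (r x) s]| = (size s * e)%N.
Proof.
rewrite /separated; elim: s => [|x0 s IHs] /=.
  by move=> _; apply: eq_card0 => x; rewrite inE andbF.
case/andP => /andP[Xx0 Xs] /andP[sep_x0 sep_s].
have -> : [set x in X | r x x0 || has (r x) s]
    = [set y | r x0 y] :|: [set x in X | has (r x) s].
  apply/setP => x; rewrite !inE [r x x0]r_sym andb_orr.
  by congr orb; apply: andb_idl => /(r_closed Xx0).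
rewrite cardsU IHs ?Xs // card_r //.
rewrite [X in (_ - X)%N]eq_card0 ?subn0 ?mulSn // => x; rewrite !inE.
apply: contraTF sep_x0 => /and3P[rx0 _ /hasP[y sy rxy]].
by apply/allPn; exists y; rewrite // negbK (r_trans rx0).
Qed.

(** A separated tuple is extended by prepending any element of [X] outside the classes of its
    entries. *)
Lemma card_separated m :
  #|[set t : m.-tuple T | separated t]|%:Z
    = \prod_(i < m) (#|X|%:Z - (i * e)%N%:Z).
Proof.
elim: m => [|m IHm].
  rewrite big_ord0; suff -> : #|[set t : 0.-tuple T | separated t]| = 1%N by [].
  by apply/eqP/cards1P; exists [tuple]; apply/setP => t; rewrite !inE tuple0.
rewrite big_ord_recr /= -{}IHm -!sum1dep_card.
rewrite (reindex (fun p : m.-tuple T * T => [tuple of p.2 :: p.1])) /=; last first.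
  exists (fun t => (behead_tuple t, thead t)) => [[t x] _ | t _] /=.
    by rewrite theadE; congr pair; apply: val_inj.
  by rewrite -tuple_eta.
rewrite (eq_bigl (fun p : m.-tuple T * T => separated p.1 &&
    (p.2 \in X :\: [set x in X | has (r x) p.1]))); last first.
  case=> t x; rewrite !inE /separated /= all_predC negb_and.
  case Xx: (x \in X) => /=; last by rewrite andbF.
  by rewrite [in RHS]andbT andbCA andbC.
rewrite -(pair_big_dep (fun t : m.-tuple T => separated t)
  (fun t x => x \in X :\: [set x in X | has (r x) t]) (fun _ _ => 1%N)) /=.
rewrite (eq_bigr (fun _ => (#|X| - m * e)%N)); last first.
  move=> t sep_t; rewrite sum1_card cardsDS ?card_has_rel ?size_tuple //.
  by apply/subsetP => x; rewrite inE => /andP[].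
rewrite sum_nat_cond_const PoszM sum1dep_card.
(* Without a separated [m]-tuple both sides vanish; with one, its classes fit in [X], so the
   truncated difference equals the integer one. *)
case: (posnP #|[set t : m.-tuple T | separated t]|) => [-> | ].
  by rewrite !mul0r.
case/card_gt0P => t; rewrite inE => sep_t; rewrite -subzn //.
rewrite -[in X in (X <= _)%N](size_tuple t) -card_has_rel //.
by apply/subset_leq_card/subsetP => x; rewrite inE => /andP[].
Qed.

(** Under the bound, all factors [#|X| - i * e] with [i < m] in the count are nonzero; conversely,
    [m] disjoint classes must fit in [X]. *)
Lemma separated_ex m : (0 < e)%N ->
  (exists t : m.-tuple T, separated t) <-> (m * e <= #|X|)%N.
Proof.
move=> e_gt0; split=> [[t sep_t] | le_meX].
  rewrite -[in X in (X <= _)%N](size_tuple t) -card_has_rel //.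
  by apply/subset_leq_card/subsetP => x; rewrite inE => /andP[].
suff: (0 < #|[set t : m.-tuple T | separated t]|)%N.
  by case/card_gt0P => t; rewrite inE; exists t.
rewrite lt0n -eqz_nat card_separated; apply/prodf_neq0 => i _.
rewrite subr_eq0 eqz_nat; apply: contraTneq le_meX => ->.
by rewrite -ltnNge ltn_mul2r ltn_ord e_gt0.
Qed.
End SeparatedTuples.

Lemma rmorphism_of (R S : pzRingType) (f : R -> S) :
  GRing.zmod_morphism f -> GRing.monoid_morphism f ->
  exists g : {rmorphism R -> S}, g = f :> (R -> S).
Proof.
move=> fB fM.
pose fZ := GRing.isZmodMorphism.Build R S f fB.
pose fMn := GRing.isMonoidMorphism.Build R S f fM.
pose g : {rmorphism R -> S} := HB.pack f fZ fMn.
by exists g.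
Qed.

(** * Evaluation of non-commutative polynomials *)

(* A sequence of pairs (coefficient, word) is a non-commutative polynomial, and
   [nceval] is its evaluation: [generates] says that evaluation at [x] is onto. *)
Definition ncpoly (F : Type) (k : nat) := seq (F * seq 'I_k).

Definition nceval (F : Type) (R : pzSemiRingType) (sc : F -> R) (k : nat)
    (x : 'I_k -> R) (w : ncpoly F k) : R :=
  \sum_(p <- w) sc p.1 * \prod_(i <- p.2) x i.

Definition ncopp (F : zmodType) (k : nat) (w : ncpoly F k) : ncpoly F k :=
  [seq (- p.1, p.2) | p <- w].

Definition ncmul (F : pzSemiRingType) (k : nat) (v w : ncpoly F k) :
  ncpoly F k := [seq (p.1 * p'.1, p.2 ++ p'.2) | p <- v, p' <- w].

Section Evaluation.
Variables (F R : pzRingType) (sc : {rmorphism F -> R}) (k : nat).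
Hypothesis sc_central : forall c a, sc c * a = a * sc c.
Implicit Types (x : 'I_k -> R) (v w : ncpoly F k).

Lemma nceval_cat x v w : nceval sc x (v ++ w) = nceval sc x v + nceval sc x w.
Proof. exact: big_cat. Qed.

Lemma nceval_opp x w : nceval sc x (ncopp w) = - nceval sc x w.
Proof.
rewrite /nceval big_map -sumrN; apply: eq_bigr => p _ /=.
by rewrite rmorphN mulNr.
Qed.

Lemma nceval_mul x v w : nceval sc x (ncmul v w) = nceval sc x v * nceval sc x w.
Proof.
rewrite /nceval /ncmul big_allpairs_dep mulr_suml; apply: eq_bigr => p _.
rewrite mulr_sumr; apply: eq_bigr => p' _ /=.
rewrite rmorphM big_cat /= !mulrA; congr (_ * _).
by rewrite -!mulrA [sc p'.1 * _]sc_central.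
Qed.

Lemma nceval_const x c : nceval sc x [:: (c, [::])] = sc c.
Proof. by rewrite /nceval big_seq1 big_nil mulr1. Qed.

Lemma nceval_var x i : nceval sc x [:: (1, [:: i])] = x i.
Proof. by rewrite /nceval !big_seq1 rmorph1 mul1r. Qed.

Lemma nceval_morph (S : pzRingType) (sc' : F -> S) (f : {rmorphism R -> S})
    x (y : 'I_k -> S) w :
  (forall c, f (sc c) = sc' c) -> (forall i, f (x i) = y i) ->
  f (nceval sc x w) = nceval sc' y w.
Proof.
move=> f_sc f_x; rewrite /nceval rmorph_sum; apply: eq_bigr => p _.
rewrite rmorphM rmorph_prod f_sc; congr (_ * _).
by apply: eq_bigr => i _; rewrite f_x.
Qed.

End Evaluation.

(** * Generating tuples of powers of a simple algebra *)

Section Simple.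
Variables (F : pzRingType) (R : finPzRingType) (sc : {rmorphism F -> R}).
Hypothesis sc_central : forall c a, sc c * a = a * sc c.
Hypothesis R_nontrivial : 1 != 0 :> R.
(** Simplicity, elementwise: the two-sided ideal of a nonzero element contains [1]. *)
Hypothesis R_simple : forall a : R, a != 0 ->
  exists uv : seq (R * R), 1 = \sum_(p <- uv) p.1 * a * p.2.

(** Injectivity gives bijectivity, as [R] is finite. *)
Definition is_alg_aut (f : R -> R) : Prop :=
  [/\ GRing.zmod_morphism f, GRing.monoid_morphism f,
      forall c, f (sc c) = sc c & injective f].

Definition alg_auts : {set {ffun R -> R}} :=
  [set f : {ffun R -> R} | pbool (is_alg_aut f)].

Lemma alg_autsP (f : {ffun R -> R}) : reflect (is_alg_aut f) (f \in alg_auts).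
Proof. by rewrite inE; apply: pboolP. Qed.

Lemma alg_auts_rmorphism f : f \in alg_auts ->
  exists g : {rmorphism R -> R}, g = f :> (R -> R).
Proof. by case/alg_autsP => fB fM _ _; apply: rmorphism_of. Qed.

Lemma alg_auts_id : [ffun a => a] \in alg_auts.
Proof.
apply/alg_autsP; split=> [a b | | c | a b]; rewrite ?ffunE //.
by split=> [|a b]; rewrite !ffunE.
Qed.

Lemma alg_auts_comp f g : f \in alg_auts -> g \in alg_auts ->
  [ffun a => f (g a)] \in alg_auts.
Proof.
move=> /alg_autsP[fB fM fsc f_inj] /alg_autsP[gB gM gsc g_inj].
apply/alg_autsP; split=> [a b | | c | a b].
- by rewrite !ffunE gB fB.
- by split=> [|a b]; rewrite !ffunE ?gM ?fM.
- by rewrite ffunE gsc fsc.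
- by rewrite !ffunE => /f_inj/g_inj.
Qed.

Lemma alg_auts_inv f : f \in alg_auts ->
  exists2 g, g \in alg_auts & cancel f g.
Proof.
case/alg_autsP => fB fM fsc f_inj.
have [g fK Kf] := injF_bij f_inj.
exists [ffun a => g a]; last by move=> a; rewrite ffunE fK.
apply/alg_autsP; split=> [a b | | c | a b]; rewrite ?ffunE.
- by apply: f_inj; rewrite fB !Kf.
- split=> [|a b]; rewrite !ffunE; apply: f_inj; rewrite Kf ?fM //.
  by rewrite !Kf.
- by apply: f_inj; rewrite Kf fsc.
- exact: (can_inj Kf).
Qed.

Section Tuples.
Variable k : nat.
Implicit Types (x y : {ffun 'I_k -> R}) (w : ncpoly F k).

Definition conj_tuples x y : bool :=
  [exists f in alg_auts, y == [ffun i => f (x i)]].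

Lemma conj_tuplesP x y :
  reflect (exists2 f, f \in alg_auts & y = [ffun i => f (x i)])
          (conj_tuples x y).
Proof. exact: 'exists_in_eqP. Qed.

Lemma conj_tuples_sym : symmetric conj_tuples.
Proof.
suff sub x y : conj_tuples x y -> conj_tuples y x.
  by move=> x y; apply/idP/idP; apply: sub.
case/conj_tuplesP => f /alg_auts_inv[g Ag fK] ->; apply/conj_tuplesP.
by exists g => //; apply/ffunP => i; rewrite !ffunE fK.
Qed.

Lemma conj_tuples_trans : transitive conj_tuples.
Proof.
move=> y x z /conj_tuplesP[f Af ->] /conj_tuplesP[g Ag ->].
apply/conj_tuplesP; exists [ffun a => g (f a)]; first exact: alg_auts_comp.
by apply/ffunP => i; rewrite !ffunE.
Qed.

Lemma nceval_aut f x w : f \in alg_auts ->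
  f (nceval sc x w) = nceval sc [ffun i => f (x i)] w.
Proof.
move=> Af; have [g fE] := alg_auts_rmorphism Af; rewrite -fE.
case/alg_autsP: Af => _ _ fsc _.
by apply: nceval_morph => [c | i]; rewrite ?ffunE fE.
Qed.

Lemma generates_conj x y :
  generates sc x -> conj_tuples x y -> generates sc y.
Proof.
move=> gen_x /conj_tuplesP[f Af ->] b.
have [g Ag fK] := alg_auts_inv Af.
have [w gbE] := gen_x (g b); exists w.
change (b = nceval sc [ffun i => f (x i)] w); rewrite -nceval_aut //.
have Kf : cancel g f by apply: canF_sym fK.
by rewrite -[RHS]/(f (nceval sc x w)) -[nceval _ _ _]gbE Kf.
Qed.

(* A generating tuple has trivial stabilizer. *)
Lemma card_conj_tuples x :
  generates sc x -> #|[set y | conj_tuples x y]| = #|alg_auts|.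
Proof.
move=> gen_x.
have -> : [set y | conj_tuples x y]
    = [set [ffun i => f (x i)] | f : {ffun R -> R} in alg_auts].
  apply/setP => y; rewrite inE.
  by apply/conj_tuplesP/imsetP => -[f Af ->]; exists f.
apply: card_in_imset => f g Af Ag eq_fg; apply/ffunP => a.
have [w ->] := gen_x a.
by rewrite -[f _]/(f (nceval sc x w)) nceval_aut // eq_fg -nceval_aut.
Qed.

(* Goursat's dichotomy: either the kernel of evaluation at [x] lies in the
   kernel of evaluation at [y], and evaluation descends to an automorphism, or
   the image of the former kernel at [y] is a nonzero two-sided ideal. *)
Lemma separating_ncpoly x y :
  generates sc x -> generates sc y -> ~~ conj_tuples x y ->
  exists w, nceval sc x w = 0 /\ nceval sc y w = 1.
Proof.
move=> gen_x gen_y.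
case: (excluded_middle_informative
        (exists w, nceval sc x w = 0 /\ nceval sc y w != 0)).
  case=> w [wx0 /R_simple[uv ->]] _.
  (* Lifting [a] and [b] along [y] turns each term of the expression of [1] into a polynomial that
     still vanishes at [x]. *)
  elim: uv => [|[a b] uv [v [vx0 vyE]]].
    by exists [::]; rewrite /nceval !big_nil.
  have [[wa aE] [wb bE]] := (gen_y a, gen_y b).
  exists (ncmul (ncmul wa w) wb ++ v).
  rewrite !nceval_cat !nceval_mul // vx0 vyE wx0 mulr0 mul0r addr0.
  by rewrite big_cons /= [a]aE [b]bE.
move=> no_w /negP[].
have eval_ext v w :
    nceval sc x v = nceval sc x w -> nceval sc y v = nceval sc y w.
  move=> eq_vw; apply/eqP; rewrite -subr_eq0 -nceval_opp -nceval_cat.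
  apply/negPn/negP => nz; apply: no_w; exists (v ++ ncopp w).
  by rewrite nceval_cat nceval_opp eq_vw subrr.
have [wx wxE] : exists wx : R -> ncpoly F k,
    forall a, nceval sc x (wx a) = a.
  apply: (@functional_choice _ _ (fun a w => nceval sc x w = a)) => a.
  by have [w ->] := gen_x a; exists w.
pose f := [ffun a => nceval sc y (wx a)].
have fE w : f (nceval sc x w) = nceval sc y w.
  by rewrite ffunE; apply: eval_ext.
apply/conj_tuplesP; exists f; last first.
  by apply/ffunP => i; rewrite ffunE -[y i](nceval_var sc) -fE nceval_var.
apply/alg_autsP; split=> [a b | | c | ].
- by rewrite -(wxE a) -(wxE b) -nceval_opp -nceval_cat !fE nceval_cat nceval_opp.
- split=> [|a b]; last first.
    by rewrite -(wxE a) -(wxE b) -nceval_mul // !fE nceval_mul.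
  by rewrite -(rmorph1 sc) -(nceval_const sc x 1) fE !nceval_const.
- by rewrite -(nceval_const sc x c) fE !nceval_const.
(* Surjectivity comes from [gen_y]; finiteness of [R] turns it into injectivity. *)
- have f_surj b : exists a, f a = b.
    by have [w ->] := gen_y b; exists (nceval sc x w); exact: fE.
  have [g gK] := functional_choice f_surj.
  exact: can_inj (canF_sym gK).
Qed.

(** * Chinese remainders for powers of a simple algebra *)

Section Power.
Variable m : nat.

Definition diag_sc (c : F) : {ffun 'I_m -> R} := [ffun => sc c].

Lemma nceval_comp (x : 'I_k -> {ffun 'I_m -> R}) w j :
  nceval diag_sc x w j = nceval sc [ffun i => x i j] w.
Proof.
rewrite /nceval sum_ffunE; apply: eq_bigr => p _; rewrite !ffunE; congr (_ * _).
by elim: p.2 => [|i s IHs]; rewrite ?big_nil ?big_cons !ffunE // IHs.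
Qed.

Theorem generates_power (x : 'I_k -> {ffun 'I_m -> R}) :
  generates diag_sc x <->
  (forall j, generates sc [ffun i => x i j]) /\
  (forall j j', j != j' ->
     ~~ conj_tuples [ffun i => x i j] [ffun i => x i j']).
Proof.
split=> [gen_x | [gen_x sep_x] b].
  split=> [j a | j j' neq_j].
    have [w aE] := gen_x [ffun => a]; exists w.
    rewrite -[RHS]/(nceval sc [ffun i => x i j] w) -nceval_comp.
    by rewrite -[nceval _ _ _]aE ffunE.
  apply/conj_tuplesP => -[f Af xE].
  (* A polynomial yielding the idempotent of [j'] vanishes at component [j], so the automorphism
     would send [0] to [1]. *)
  have [w wE] := gen_x [ffun l => (l == j')%:R].
  have wjE l : nceval sc [ffun i => x i l] w = (l == j')%:R.
    by rewrite -nceval_comp -[nceval _ _ _]wE ffunE.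
  have := wjE j'; rewrite eqxx xE -nceval_aut // wjE (negbTE neq_j).
  have [g <-] := alg_auts_rmorphism Af.
  by rewrite rmorph0 => /eqP; rewrite eq_sym (negbTE R_nontrivial).
(* Coordinate idempotents: multiply, over all [l != j], polynomials that are [0] at component [l]
   and [1] at [j]. *)
have idem j : exists w, forall l, nceval sc [ffun i => x i l] w = (l == j)%:R.
  suff [w [wj wl]] : exists w, nceval sc [ffun i => x i j] w = 1 /\
      forall l, l \in rem j (enum 'I_m) -> nceval sc [ffun i => x i l] w = 0.
    exists w => l; case: eqVneq => [-> // | neq_lj]; apply: wl.
    by rewrite mem_rem_uniq ?enum_uniq // inE neq_lj mem_enum.
  have: j \notin rem j (enum 'I_m) by rewrite mem_rem_uniqF ?enum_uniq.
  elim: (rem j _) => [_ | l s IHs].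
    exists [:: (1, [::])]; split=> //; first by rewrite nceval_const rmorph1.
  rewrite inE negb_or => /andP[neq_jl /IHs[w [wj ws]]].
  have [v [vl vj]] : exists v, nceval sc [ffun i => x i l] v = 0 /\
      nceval sc [ffun i => x i j] v = 1.
    by apply: separating_ncpoly => //; apply: sep_x; rewrite eq_sym.
  exists (ncmul v w); split=> [|l']; rewrite nceval_mul // ?vj ?wj ?mulr1 // inE.
  by case/predU1P => [-> | /ws ->]; rewrite ?vl ?mul0r ?mulr0.
have [e eE] := functional_choice idem.
have [w wE] := functional_choice (fun j => gen_x j (b j)).
exists (\big[cat/[::]]_j ncmul (w j) (e j)).
rewrite -[RHS]/(nceval diag_sc x _); apply/ffunP => l; rewrite nceval_comp.
have nil0 : nceval sc [ffun i => x i l] [::] = 0 by exact: big_nil.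
rewrite (big_morph _ (nceval_cat sc _) nil0) (bigD1 l) //= nceval_mul //.
rewrite eE eqxx mulr1 big1 ?addr0 => [|j neq_jl]; first exact: wE.
by rewrite nceval_mul // eE eq_sym (negbTE neq_jl) mulr0.
Qed.

Let to_tuple (x : {ffun 'I_k -> {ffun 'I_m -> R}}) : m.-tuple {ffun 'I_k -> R} :=
  [tuple [ffun i => x i j] | j < m].

Let to_tuple_bij : bijective to_tuple.
Proof.
exists (fun t : m.-tuple {ffun 'I_k -> R} =>
          [ffun i => [ffun j => tnth t j i]]) => [x | t].
  by apply/ffunP => i; apply/ffunP => j; rewrite !ffunE tnth_mktuple ffunE.
apply/eq_from_tnth => j; rewrite tnth_mktuple.
by apply/ffunP => i; rewrite !ffunE.
Qed.

Lemma generates_power_separated (x : {ffun 'I_k -> {ffun 'I_m -> R}}) :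
  generates diag_sc x <->
  all (mem (Gen sc k)) (to_tuple x) &&
  pairwise (fun y z => ~~ conj_tuples y z) (to_tuple x).
Proof.
have tE j : tnth (to_tuple x) j = [ffun i => x i j] by rewrite tnth_mktuple.
rewrite generates_power; split=> [[gen_x sep_x] | /andP[/allP gen_x sep_x]].
  apply/andP; split.
    by apply/allP => _ /tnthP[j ->]; rewrite tE /= inE; apply/pboolP.
  (* Both indices are below [m], so the default [0] is never read. *)
  apply/(pairwiseP 0) => i j; rewrite !inE size_tuple => lt_im lt_jm lt_ij.
  rewrite -(tnth_nth 0 (to_tuple x) (Ordinal lt_im)).
  rewrite -(tnth_nth 0 (to_tuple x) (Ordinal lt_jm)) !tE sep_x //.
  by rewrite -val_eqE /= neq_ltn lt_ij.
have sep_lt (j j' : 'I_m) : (j < j')%N ->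
    ~~ conj_tuples [ffun i => x i j] [ffun i => x i j'].
  move=> lt_j; move/(pairwiseP 0): sep_x => /(_ j j').
  by rewrite !inE size_tuple !ltn_ord -!tnth_nth !tE; apply.
split=> [j | j j'].
  by apply/pboolP; have := gen_x _ (mem_tnth j (to_tuple x)); rewrite tE /= inE.
by rewrite neq_ltn => /orP[/sep_lt | /sep_lt] //; rewrite conj_tuples_sym.
Qed.

Let Gen_closed x y : x \in Gen sc k -> conj_tuples x y -> y \in Gen sc k.
Proof.
rewrite !inE => /pboolP gen_x rxy.
by apply/pboolP; apply: generates_conj rxy.
Qed.

Let card_conj x : x \in Gen sc k -> #|[set y | conj_tuples x y]| = #|alg_auts|.
Proof. by rewrite inE => /pboolP; apply: card_conj_tuples. Qed.

Theorem card_generators_power :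
  #|[set x : {ffun 'I_k -> {ffun 'I_m -> R}} | pbool (generates diag_sc x)]|%:Z
    = \prod_(i < m) (#|Gen sc k|%:Z - (i * #|alg_auts|)%N%:Z).
Proof.
rewrite -(card_separated conj_tuples_sym conj_tuples_trans Gen_closed card_conj).
rewrite -(on_card_preimset (f := to_tuple)); last exact: onW_bij.
congr (Posz #|pred_of_set _|); apply/setP => x; rewrite !inE.
by apply/pboolP/idP => /generates_power_separated.
Qed.

Theorem generators_power_ex :
  (exists x : 'I_k -> {ffun 'I_m -> R}, generates diag_sc x)
    <-> (m * #|alg_auts| <= #|Gen sc k|)%N.
Proof.
have auts_gt0 : (0 < #|alg_auts|)%N.
  by apply/card_gt0P; exists [ffun a => a]; apply: alg_auts_id.
rewrite -(separated_ex conj_tuples_sym conj_tuples_trans Gen_closed card_conj) //.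
have [from fromK toK] := to_tuple_bij.
split=> [[x gen_x] | [t sep_t]]; last first.
  by exists (from t); apply/generates_power_separated; rewrite toK.
(* The bare function [x] and its finite-function copy have equal evaluations. *)
exists (to_tuple [ffun i => x i]); apply/generates_power_separated => b.
have [w ->] := gen_x b; exists w; apply: eq_bigr => p _; congr (_ * _).
by apply: eq_bigr => i _; rewrite ffunE.
Qed.

End Power.
End Tuples.
End Simple.

(** * Automorphisms of finite field extensions *)

Section Frobenius.
Variables (F L : finFieldType) (iota : {rmorphism F -> L}).
Local Notation q := #|F|.

(** The morphism argument records that [F] embeds in [L], which makes [q ^ i] a power of the
    characteristic of [L] and the map additive. *)
Definition frobenius of {rmorphism F -> L} :=
  fun (i : nat) (z : L) => z ^+ (q ^ i).

Lemma pchar_nat_card_base i : [pchar L].-nat (q ^ i)%N.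
Proof.
have [p pr_p chFp] := finPcharP F; have chLp := rmorph_pchar iota chFp.
rewrite pnatX (eq_pnat _ (pcharf_eq chLp)) -cardsT.
by have /abelem_pgroup := fin_ring_pchar_abelem chFp; rewrite /pgroup => ->.
Qed.

Lemma frobenius_zmod_morphism i : GRing.zmod_morphism (frobenius iota i).
Proof.
move=> x y; have chq := pchar_nat_card_base i.
by rewrite /frobenius exprDn_pchar // exprNn_pchar.
Qed.

Lemma frobenius_monoid_morphism i : GRing.monoid_morphism (frobenius iota i).
Proof. by split=> [|x y]; rewrite /frobenius ?expr1n ?exprMn. Qed.

HB.instance Definition _ i := GRing.isZmodMorphism.Build L L (frobenius iota i)
  (frobenius_zmod_morphism i).
HB.instance Definition _ i := GRing.isMonoidMorphism.Build L L (frobenius iota i)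
  (frobenius_monoid_morphism i).

Lemma frobenius_base i c : frobenius iota i (iota c) = iota c.
Proof.
rewrite /frobenius -rmorphXn; congr (iota _).
by elim: i => [|i IHi]; rewrite ?expr1 // expnSr exprM IHi expf_card.
Qed.

(** Over [F], [X^q - X] is the product of all [X - c], so its roots in [L] come from [F]. *)
Lemma frobenius1_fixed z : z ^+ q = z -> exists c, z = iota c.
Proof.
move=> zq; have /(congr1 (fun p => (map_poly iota p).[z])) := finField_genPoly F.
rewrite rmorphB /= map_polyXn map_polyX rmorph_prod horner_prod !hornerE zq subrr.
move/esym/eqP; rewrite prodf_seq_eq0 => /hasP[c _ /=].
by rewrite map_polyXsubC hornerXsubC subr_eq0 => /eqP->; exists c.
Qed.

Lemma finField_mul_generator :
  exists w : L, forall z, z != 0 -> exists i, z = w ^+ i.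
Proof.
have /cyclicP[u uE] := field_unit_group_cyclic [set: {unit L}]%G.
exists (val u) => z; rewrite -unitfE => Uz.
have: FinRing.unit L Uz \in <[u]>%g by rewrite -uE inE.
by case/cycleP => i /(congr1 val) /= ->; exists i; rewrite -FinRing.val_unitX.
Qed.

Variable s : nat.
Hypothesis s_gt0 : (0 < s)%N.
Hypothesis cardL : #|L| = (q ^ s)%N.

(** If the powers [a < b] agreed, ['X^(q ^ b) - 'X^(q ^ a)] would have [q ^ s] roots, more than its
    degree. *)
Lemma frobenius_inj (i j : 'I_s) :
  frobenius iota i =1 frobenius iota j -> i = j.
Proof.
have q_gt1 := finNzRing_gt1 F.
have no_lt (a b : 'I_s) :
    frobenius iota a =1 frobenius iota b -> (a < b)%N -> False.
  move=> eq_ab lt_ab; pose p : {poly L} := 'X^(q ^ b) - 'X^(q ^ a).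
  have lt_q : (q ^ a < q ^ b)%N by rewrite ltn_exp2l.
  have sz_p : size p = (q ^ b).+1.
    by rewrite size_polyDl size_polyXn // size_polyN size_polyXn ltnS.
  have: (size (enum L) < size p)%N.
    apply: max_poly_roots; rewrite ?enum_uniq -?size_poly_eq0 ?sz_p //.
    apply/allP => z _; rewrite rootE !hornerE.
    by have /= := eq_ab z; rewrite /frobenius => ->; rewrite subrr.
  by rewrite sz_p -cardE cardL ltnS leq_exp2l // leqNgt ltn_ord.
move=> eq_ij; apply: val_inj.
by case: (ltngtP i j) => // /no_lt []// z; rewrite eq_ij.
Qed.

(* If [w] generates the unit group, the coefficients of the product of the
   [X - w^(q^i)] are Frobenius-invariant, hence in [F]; so [sigma w] is a root. *)
Lemma base_morphism_frobenius (sigma : {rmorphism L -> L}) :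
  (forall c, sigma (iota c) = iota c) ->
  exists i : 'I_s, sigma =1 frobenius iota i.
Proof.
move=> sigma_base; have [w wgen] := finField_mul_generator.
pose p := \prod_(i < s) ('X - (w ^+ (q ^ i))%:P).
(* Frobenius shifts the roots cyclically, since [w ^+ (q ^ s) = w]. *)
have p_frob : map_poly (frobenius iota 1) p = p.
  rewrite /p map_prod_XsubC; case: (s) (s_gt0) cardL => // s' _ cardL'.
  rewrite big_ord_recr [RHS]big_ord_recl mulrC /= {2}/frobenius -exprM -expnSr.
  rewrite -cardL' expf_card expr1; congr (_ * _); apply: eq_bigr => i _.
  by rewrite /frobenius -exprM -expnSr.
have p_sigma : map_poly sigma p = p.
  apply/polyP => i; rewrite coef_map /=.
  have [|c ->] := @frobenius1_fixed p`_i; last exact: sigma_base.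
  by rewrite -[in RHS]p_frob coef_map.
have: root p (sigma w).
  rewrite -p_sigma fmorph_root; apply/rootP; rewrite horner_prod.
  by rewrite (bigD1 (Ordinal s_gt0)) //= hornerXsubC expr1 subrr mul0r.
rewrite /root horner_prod prodf_seq_eq0 => /hasP[i _ /=].
rewrite hornerXsubC subr_eq0 => /eqP sigma_w; exists i => z.
have [-> | /wgen[j ->]] := eqVneq z 0; first by rewrite !rmorph0.
by rewrite !rmorphXn sigma_w.
Qed.

End Frobenius.

(** * Automorphisms of matrix algebras *)

(** Entry [(k, j)] of the commutation with [delta_mx i j] reads [M k i = M j j *+ (k == i)]. *)
Lemma comm_delta_scalar (R : nzRingType) (n : nat) (M : 'M[R]_n) :
  (forall i j, M *m delta_mx i j = delta_mx i j *m M) -> is_scalar_mx M.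
Proof.
case: n M => [|n] M comm_M; first by apply/is_scalar_mxP; exists 0; apply/matrixP => -[].
have entry k i j : M k i = M j j *+ (k == i).
  have := congr1 (fun N : 'M_n.+1 => N k j) (comm_M i j).
  rewrite -(mul_delta_mx (0 : 'I_1) i j) mulmxA -colE -mulmxA -rowE !mxE !big_ord1.
  by rewrite !mxE !eqxx mulr1 andbT mulr_natl.
apply/is_scalar_mxP; exists (M 0 0); apply/matrixP => k i.
by rewrite mxE; apply: entry.
Qed.

(** Matrix units move a nonzero entry [a p q] to each diagonal place [(i, i)], where it is
    normalized to [1]. *)
Lemma matrix_simple (K : fieldType) (n : nat) (a : 'M[K]_n) : a != 0 ->
  exists uv : seq ('M[K]_n * 'M[K]_n),
    1%:M = \sum_(p <- uv) p.1 *m a *m p.2.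
Proof.
case/matrix0Pn => p [q nz_a].
exists [seq ((a p q)^-1 *: delta_mx i p, delta_mx q i) | i <- enum 'I_n].
rewrite big_map big_enum /= mx1_sum_delta; apply: eq_bigr => i _.
rewrite -!scalemxAl -(mul_delta_mx (0 : 'I_1) i p) -(mul_delta_mx (0 : 'I_1) q i).
rewrite -!mulmxA (mulmxA _ a) -rowE (mulmxA (row p a)) -colE.
have -> : col q (row p a) = (a p q)%:M.
  by apply/matrixP => k l; rewrite !ord1 !mxE mulr1n.
by rewrite mul_scalar_mx -scalemxAr mul_delta_mx scalerA mulVf // scale1r.
Qed.

(* The intertwiner [P] has columns [f(E_b0) w], where [w] is a nonzero column
   of the idempotent [f(E_00)]. *)
Lemma skolem_noether_semilinear (K : finFieldType) (n : nat)
    (f : {rmorphism 'M[K]_n.+1 -> 'M[K]_n.+1}) : injective f ->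
  exists sigma : {rmorphism K -> K},
    (forall c, f c%:M = (sigma c)%:M) /\
    exists2 P : 'M[K]_n.+1, P \in unitmx &
      forall a, f a = P *m map_mx sigma a *m invmx P.
Proof.
move=> f_inj; have [g _ gK] := injF_bij f_inj.
have fM a b : f (a *m b) = f a *m f b by exact: rmorphM.
(* As [f] is onto, the image of a central element commutes with all matrix units. *)
have f_scalar c : f c%:M = (f c%:M 0 0)%:M.
  have /is_scalar_mxP[d fcE] : is_scalar_mx (f c%:M).
    apply: comm_delta_scalar => i j.
    by rewrite -(gK (delta_mx i j)) -!fM scalar_mxC.
  by rewrite fcE mxE.
have sB : GRing.zmod_morphism (fun c => f c%:M 0 0).
  by move=> c d; rewrite /= !raddfB /= !mxE.
have sM : GRing.monoid_morphism (fun c => f c%:M 0 0).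
  split=> [|c d]; first by rewrite rmorph1 mxE.
  by rewrite scalar_mxM fM (f_scalar c) (f_scalar d) -scalar_mxM !mxE eqxx !mulr1n.
have [sigma sE] := rmorphism_of sB sM.
have f_sigma c : f c%:M = (sigma c)%:M by rewrite f_scalar sE.
exists sigma; split=> //.
have nz_e : f (delta_mx 0 0) != 0.
  rewrite raddf_eq0 //; apply/matrix0Pn.
  by exists 0, 0; rewrite mxE eqxx oner_neq0.
have [k [l nz_kl]] := matrix0Pn _ nz_e.
pose w := col l (f (delta_mx 0 0)).
have ew : f (delta_mx 0 0) *m w = w.
  by rewrite /w colE mulmxA -fM mul_delta_mx.
have nz_w : w != 0 by apply/cV0Pn; exists k; rewrite mxE.
pose P : 'M[K]_n.+1 := \matrix_(a, b) (f (delta_mx b 0) *m w) a 0.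
(* On the left [delta_mx b 0] is a basis column, on the right a matrix unit. *)
have PE b : P *m delta_mx b 0 = f (delta_mx b 0) *m w.
  by rewrite -colE; apply/matrixP => i j; rewrite !ord1 !mxE.
have fP a b : f (delta_mx a b) *m P = P *m delta_mx a b.
  apply/matrixP => i j.
  suff: col j (f (delta_mx a b) *m P) = col j (P *m delta_mx a b).
    by move/matrixP/(_ i 0); rewrite !mxE.
  rewrite !colE -!mulmxA PE mulmxA -fM !mul_delta_mx_cond.
  by case: (b == j); rewrite ?mulr1n ?PE // !mulr0n raddf0 mul0mx mulmx0.
(* If [P] kills the column [v^T], applying [f (delta_mx 0 i)] to [P *m v^T] gives [v 0 i *: w = 0],
   and [w] is nonzero. *)
have P_unit : P \in unitmx.
  rewrite unitmxE unitfE -det_tr; apply/det0P => -[v nz_v vP].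
  have Pc : P *m v^T = 0 by rewrite -[P]trmxK -trmx_mul vP trmx0.
  case/rV0Pn: nz_v => i /eqP[]; apply/eqP.
  suff: v 0 i *: w == 0 by rewrite scaler_eq0 (negbTE nz_w) orbF.
  have: f (delta_mx 0 i) *m P *m v^T = 0 by rewrite -mulmxA Pc mulmx0.
  rewrite fP -mulmxA -(mul_delta_mx (0 : 'I_1) 0 i) -mulmxA -rowE mulmxA PE ew.
  have -> : row i v^T = (v 0 i)%:M.
    by apply/matrixP => x y; rewrite !ord1 !mxE mulr1n.
  by rewrite mul_mx_scalar => ->.
have fZ c i j : f (c *: delta_mx i j) *m P = P *m (sigma c *: delta_mx i j).
  by rewrite -mul_scalar_mx fM f_sigma mul_scalar_mx -scalemxAl fP -scalemxAr.
exists P => // a; suff <- : f a *m P = P *m map_mx sigma a by rewrite mulmxK.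
rewrite {1}[a]matrix_sum_delta [map_mx _ _]matrix_sum_delta.
rewrite raddf_sum mulmx_suml mulmx_sumr; apply: eq_bigr => i _.
rewrite raddf_sum mulmx_suml mulmx_sumr; apply: eq_bigr => j _.
by rewrite mxE; apply: fZ.
Qed.

(** * Structure map of the matrix algebra and the scalar subgroup *)

Lemma scA_zmod_morphism (F L : finFieldType) (iota : {rmorphism F -> L}) n :
  GRing.zmod_morphism (scA iota n).
Proof. by move=> x y; rewrite /scA rmorphB; apply: (raddfB (@scalar_mx L n)). Qed.

Lemma scA_monoid_morphism (F L : finFieldType) (iota : {rmorphism F -> L}) n :
  GRing.monoid_morphism (scA iota n).
Proof.
split=> [|x y]; rewrite /scA ?rmorph1 // rmorphM; exact: scalar_mxM.
Qed.

HB.instance Definition _ (F L : finFieldType) (iota : {rmorphism F -> L}) n :=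
  GRing.isZmodMorphism.Build F (matA L n) (scA iota n) (scA_zmod_morphism iota n).
HB.instance Definition _ (F L : finFieldType) (iota : {rmorphism F -> L}) n :=
  GRing.isMonoidMorphism.Build F (matA L n) (scA iota n)
    (scA_monoid_morphism iota n).

Lemma GLscalars_group_set (n : nat) (L : finFieldType) :
  group_set (GLscalars n L).
Proof.
apply/group_setP; split; first by rewrite inE scalar_mx_is_scalar.
move=> g h; rewrite !inE => /is_scalar_mxP[a gE] /is_scalar_mxP[b hE].
by rewrite GL_MxE gE hE -scalar_mxM scalar_mx_is_scalar.
Qed.

Canonical GLscalars_group (n : nat) (L : finFieldType) :=
  Group (GLscalars_group_set n L).

(** Scalar matrices are central, hence normalized by the whole group, and Lagrange applies. *)
Lemma card_GL_PGL (n : nat) (L : finFieldType) :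
  (#|GLscalars n L| * #|PGL n L|)%N = #|'GL_n[L]%g|.
Proof.
rewrite /PGL card_quotient.
  by apply: Lagrange; apply/subsetP => g _; rewrite inE.
apply/subsetP => g _; rewrite inE; apply/subsetP => _ /imsetP[z zZ ->].
move: zZ; rewrite !inE => /is_scalar_mxP[a zE].
rewrite conjgE !GL_MxE zE -scalar_mxC mulmxA -GL_MxE mulVg.
by rewrite mul1mx scalar_mx_is_scalar.
Qed.

(** * Counting the automorphisms of a matrix algebra over the base field *)

Section MatrixAutomorphisms.
Variables (F L : finFieldType) (iota : {rmorphism F -> L}) (s n : nat).
Hypothesis s_gt0 : (0 < s)%N.
Hypothesis cardL : #|L| = (#|F| ^ s)%N.

Let aut_of (p : 'I_s * {'GL_n.+1[L]}) : {ffun matA L n.+1 -> matA L n.+1} :=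
  [ffun a => GLval p.2 *m map_mx (frobenius iota p.1) a *m invmx (GLval p.2)].

Let GLval_unit (g : {'GL_n.+1[L]}) : GLval g \in unitmx.
Proof. exact: GL_unit. Qed.

Let aut_ofP p : aut_of p \in alg_auts (scA iota n.+1).
Proof.
case: p => i g; apply/alg_autsP; split=> [a b | | c | a b].
- rewrite !ffunE /= map_mxB; set X := map_mx _ a; set Y := map_mx _ b.
  have : GLval g *m (X - Y) *m invmx (GLval g)
      = GLval g *m X *m invmx (GLval g) - GLval g *m Y *m invmx (GLval g).
    by rewrite mulmxBr mulmxBl.
  exact.
- split=> [|a b]; rewrite !ffunE /=.
    by rewrite map_mx1 mulmx1 mulmxV.
  by rewrite map_mxM -[RHS]/(_ *m _) !mulmxA mulmxKV.
- rewrite ffunE /= /scA map_scalar_mx /= frobenius_base.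
  by rewrite scalar_mxC mulmxK.
rewrite !ffunE /= => /(can_inj (mulmxKV (GLval_unit g))).
by move/(can_inj (mulKmx (GLval_unit g)))/map_mx_inj.
Qed.

(** The field part [sigma] given by Skolem-Noether fixes [F] because [f] does, so it is a Frobenius
    power. *)
Let aut_of_onto f : f \in alg_auts (scA iota n.+1) -> exists p, f = aut_of p.
Proof.
case/alg_autsP => fB fM fsc f_inj.
have [g gE] : exists g : {rmorphism 'M[L]_n.+1 -> 'M[L]_n.+1},
    g = f :> ('M[L]_n.+1 -> 'M[L]_n.+1) by apply: rmorphism_of.
have g_inj : injective g by rewrite gE.
have [sigma [g_sigma [P P_unit gP]]] := skolem_noether_semilinear g_inj.
have sigma_base c : sigma (iota c) = iota c.
  have := fsc c; rewrite -[f _]/((f : 'M_n.+1 -> 'M_n.+1) _) -gE /scA g_sigma.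
  by move/matrixP/(_ 0 0); rewrite !mxE.
have [i iE] := base_morphism_frobenius s_gt0 cardL sigma_base.
exists (i, FinRing.unit 'M[L]_n.+1 P_unit); apply/ffunP => a; rewrite ffunE /=.
rewrite -[f _]/((f : 'M_n.+1 -> 'M_n.+1) _) -gE gP.
by congr (_ *m _ *m _); apply: eq_map_mx.
Qed.

(** The values on scalar matrices determine the Frobenius exponent. Frobenius fixes matrix units, so
    two conjugators with equal effect differ by a matrix commuting with these, hence by a scalar. *)
Let aut_of_fiber i g :
  [set p | aut_of p == aut_of (i, g)]
    = setX [set i] (g *: GLscalars n.+1 L)%g.
Proof.
apply/setP => -[j h]; rewrite !inE /= mem_lcoset inE GL_MxE.
apply/eqP/andP => [/ffunP eq_aut | [/eqP-> /is_scalar_mxP[c hE]]]; last first.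
  have hgc : GLval h = GLval g *m c%:M.
    by rewrite -hE mulmxA mulmxV ?mul1mx.
  apply/ffunP => a; rewrite !ffunE /= hgc.
  have := GLval_unit (g^-1 * h)%g; rewrite GL_MxE hE => c_unit.
  have gc_unit : GLval g *m c%:M \in unitmx by rewrite unitmx_mul GLval_unit.
  apply: (canLR (mulmxK gc_unit)); rewrite !mulmxA mulmxKV ?GLval_unit //.
  by rewrite -!mulmxA scalar_mxC.
have eq_ij : j = i.
  apply: (frobenius_inj cardL (iota := iota)) => c.
  have := eq_aut c%:M; rewrite !ffunE /= !map_scalar_mx /=.
  rewrite !scalar_mxC !mulmxK ?GLval_unit //.
  by move/matrixP/(_ 0 0); rewrite !mxE.
split; first exact/eqP.
apply: comm_delta_scalar => k l; have := eq_aut (delta_mx k l).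
rewrite !ffunE /= !map_delta_mx => eq_kl.
have : GLval h *m delta_mx k l
    = GLval g *m delta_mx k l *m (invmx (GLval g) *m GLval h).
  by rewrite mulmxA -eq_kl mulmxKV ?GLval_unit.
move/(congr1 (mulmx (invmx (GLval g)))).
by rewrite -!mulmxA mulKmx // => <-.
Qed.

(** The [s * #|GL|] parameters of [aut_of] split into fibres that are cosets of the scalars. *)
Theorem card_alg_auts_matrix :
  #|alg_auts (scA iota n.+1)| = (s * #|PGL n.+1 L|)%N.
Proof.
apply/eqP; rewrite -(eqn_pmul2r (cardG_gt0 (GLscalars_group n.+1 L))) /=.
rewrite -mulnA [(#|PGL _ _| * _)%N]mulnC card_GL_PGL.
have <- : #|[set: 'I_s * {'GL_n.+1[L]}]| = (s * #|'GL_n.+1[L]%g|)%N.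
  by rewrite cardsT card_prod card_ord cardsT.
rewrite -sum1_card (partition_big_imset aut_of) /=.
have -> : aut_of @: [set: 'I_s * {'GL_n.+1[L]}] = alg_auts (scA iota n.+1).
  apply/setP => f; apply/imsetP/idP => [[p _ ->] | /aut_of_onto[p ->]] //.
  by exists p.
rewrite -sum_nat_const; apply/eqP; apply: eq_bigr => f /aut_of_onto[[i g] ->].
transitivity #|[set p | aut_of p == aut_of (i, g)]|.
  by rewrite aut_of_fiber cardsX cards1 mul1n card_lcoset.
by rewrite -sum1dep_card; apply: eq_bigl => p; rewrite inE.
Qed.

End MatrixAutomorphisms.

(* F = F_q, L = F_{q^s} (with |L| = |F|^s), viewed as an F-algebra via iota.
   A = M_n(L), A^m = {ffun 'I_m -> 'M[L]_n} (componentwise ring). *)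
Theorem mainTheorem10 (F L : finFieldType) (iota : {rmorphism F -> L})
    (n s k m : nat) (hn : (0 < n)%N) (hs : (0 < s)%N) (hk : (0 < k)%N)
    (hm : (0 < m)%N) (hL : #|L| = (#|F| ^ s)%N) :
  ((exists x : 'I_k -> prodmx L n m, generates (scAm iota n m) x) <->
     (m * (s * #|PGL n L|) <= #|Gen (scA iota n) k|)%N)
  /\
  (#|Gen (scAm iota n m) k|%:Z =
     \prod_(i < m) (#|Gen (scA iota n) k|%:Z - (i * s * #|PGL n L|)%N%:Z)).
Proof.
case: n hn => // n' _.
have sc_central c (a : matA L n'.+1) :
    scA iota n'.+1 c * a = a * scA iota n'.+1 c.
  exact/esym/scalar_mxC.
have A_nontrivial : 1 != 0 :> matA L n'.+1 by exact: (oner_neq0 'M[L]_n'.+1).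
have A_simple := @matrix_simple L n'.+1.
have cardA := card_alg_auts_matrix iota n' hs hL.
split.
  rewrite -cardA.
  (* [scAm] is convertible to [diag_sc] over [scA], so the general result applies directly. *)
  exact (generators_power_ex sc_central A_nontrivial A_simple k m).
under eq_bigr => i _ do rewrite -mulnA -cardA.
exact (card_generators_power sc_central A_nontrivial A_simple k m).
Qed.
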